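(* Say that a word over an alphabet $\{0,1,\ldots,r\}$, $r\ge 1$, satisfies $\mathcal R$ if $0$ appears in it only in runs of even length, and $1$ appears in it only in runs whose length is divisible by $3$. Let $f_0(n)$ be the number of binary words (over $\{0,1\}$) of length $n-1$ satisfying $\mathcal R$, and let $f_m$, $c_m$ be the functions associated with $f_0$ as in the context. Then: (1) For $m\ge 0$, the function $f_m$ satisfies $f_m(1)=1$, $f_m(2)=m$, $f_m(3)=m^2+1$, and $f_m(n+3)=mf_m(n+2)+f_m(n+1)+f_m(n)$ for $n>1$. (2) For $m\ge 0$ and $n\ge 1$, $f_m(n)$ is the number of words of length $n-1$ over $\{0,1,\ldots,m+1\}$ satisfying $\mathcal R$. (3) For $m\ge 1$ and $1\le k\le n$, $c_m(n,k)$ is the number of words of length $n-1$ over $\{0,1,\ldots,m+1\}$ having exactly $k-1$ letters equal to $m+1$ and satisfying $\mathcal R$.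
   Context: For an arithmetic function $f_0$ defined on the positive integers, define recursively for $m\ge 1$ and $1\le k\le n$: $c_m(n,k)=\sum_{i_1+\cdots+i_k=n} f_{m-1}(i_1)\cdots f_{m-1}(i_k)$, the sum over positive integers $i_1,\ldots,i_k$, and $f_m(n)=\sum_{k=1}^n c_m(n,k)$. A run is a maximal block of consecutive equal letters. *)

(* Defs.v *)
From mathcomp Require Import all_boot.
Set Implicit Arguments.
Unset Strict Implicit.
Unset Printing Implicit Defensive.

(* An arithmetic function on the positive integers is encoded as a function
   nat -> nat; its value at 0 never affects the values considered at positive
   integers. *)

(* The sum of f(i_1)...f(i_k) over all positive i_1, ..., i_k with
   i_1 + ... + i_k = n; every such i_j is at most n, hence the index type. *)
Definition composition_sum (f : nat -> nat) (n k : nat) : nat :=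
  \sum_(i : {ffun 'I_k -> 'I_n.+1} |
          [forall j, 0 < i j] && (\sum_(j < k) i j == n))
     \prod_(j < k) f (i j).

Fixpoint iter_f (f0 : nat -> nat) (m n : nat) : nat :=
  if m is m'.+1 then \sum_(1 <= k < n.+1) composition_sum (iter_f f0 m') n k
  else f0 n.

(* Meaningful for m >= 1 only. *)
Definition iter_c (f0 : nat -> nat) (m n k : nat) : nat :=
  composition_sum (iter_f f0 m.-1) n k.

(* The positions i, ..., j - 1 of w form a run of the letter a; onth w p is
   None when p is past the end of w. *)
Definition is_run (a : nat) (w : seq nat) (i j : nat) : bool :=
  [&& i < j,
      all (fun p => onth w p == Some a) (iota i (j - i)),
      (0 < i) ==> (onth w i.-1 != Some a)
    & onth w j != Some a].

Definition runs_dvd (a d : nat) (w : seq nat) : bool :=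
  [forall i : 'I_(size w).+1, forall j : 'I_(size w).+1,
     is_run a w i j ==> (d %| j - i)].

Definition satR (w : seq nat) : bool := runs_dvd 0 2 w && runs_dvd 1 3 w.

(* Words of length l over the alphabet {0, ..., r} satisfying R. *)
Definition Rwords (r l : nat) : {set l.-tuple 'I_r.+1} :=
  [set w : l.-tuple 'I_r.+1 | satR [seq nat_of_ord x | x <- w]].

Definition binary_f0 (n : nat) : nat := #|Rwords 1 n.-1|.

(* Main.v *)
Require Import Defs.
From mathcomp Require Import all_boot.
From mathcomp Require Import zify.

(** Extend R to words over [{0, ..., r}]: letters above 1 are unrestricted.
    Such a letter [x] is a separator, since no run of 0 or 1 crosses it:
    [u x v] satisfies R exactly when [u] and [v] do ([satR_sep]).  Apply this
    to the largest letter.  A word of length [n - 1] with [k - 1] occurrences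
    of the largest letter is cut by them into [k] words over the smaller
    alphabet, of lengths [i_1 - 1, ..., i_k - 1] with [i_1 + ... + i_k = n],
    each satisfying R independently.  So if [f i] counts the words of length
    [i - 1] over the smaller alphabet, the composition sum of [f] counts the
    words over the larger one by the number of their largest letters.  Here
    this is proved by induction on [k]: removing the first part of a
    composition ([bounded_composition_sumS]) matches cutting a word at its
    first separator ([nwords_satR_top]).  Summing over [k] and then inducting
    on [m] shows that [f_m] counts words over [{0, ..., m + 1}]
    ([iter_f_words]).

    The recurrence comes from the start of the word: the words satisfying R
    form the free monoid on the blocks [00], [111] and the [m] letters
    [2, ..., m + 1] ([nwords_satR_rec]). *)

Set Implicit Arguments.
Unset Strict Implicit.
Unset Printing Implicit Defensive.

(** * Runs of a letter *)

Lemma is_runP a w i j :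
  reflect [/\ i < j,
              forall p, i <= p < j -> onth w p = Some a,
              0 < i -> onth w i.-1 <> Some a
            & onth w j <> Some a]
          (is_run a w i j).
Proof.
apply: (iffP and4P) => -[ltij run before after]; split=> //.
- move=> p lepj; apply/eqP/(allP run).
  by rewrite mem_iota; lia.
- by move=> i_gt0; apply/eqP; move: before; rewrite i_gt0.
- exact/eqP.
- by apply/allP=> p; rewrite mem_iota => pin; apply/eqP/run; lia.
- by apply/implyP=> /before/eqP.
- exact/eqP.
Qed.

(** The bound on the end of a run is automatic: no letter is read past the
    end of the word. *)
Lemma runs_dvdP a d w :
  reflect (forall i j, is_run a w i j -> d %| j - i) (runs_dvd a d w).
Proof.
apply: (iffP 'forall_forallP) => [dvd i j runij | dvd i j]; last first.
  by apply/implyP/dvd.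
have lejw : j <= size w.
  have [ltij run _ _] := is_runP _ _ _ _ runij.
  have : onth w j.-1 by rewrite run //; lia.
  by rewrite onthTE; lia.
have [ltij _ _ _] := is_runP _ _ _ _ runij.
have ltj : j < (size w).+1 by lia.
have lti : i < (size w).+1 by lia.
exact: (implyP (dvd (Ordinal lti) (Ordinal ltj))).
Qed.

(** A letter different from [a] separates the runs of [a] on its left from
    those on its right. *)
Lemma runs_dvd_sep a d u x v : x != a ->
  runs_dvd a d (u ++ x :: v) = runs_dvd a d u && runs_dvd a d v.
Proof.
move=> neqxa.
have atl p : p < size u -> onth (u ++ x :: v) p = onth u p.
  by move=> ltp; rewrite onth_cat ltp.
have atx : onth (u ++ x :: v) (size u) <> Some a.
  by rewrite onth_cat ltnn subnn /= => -[/eqP]; apply/negP.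
have atr p : onth (u ++ x :: v) ((size u).+1 + p) = onth v p.
  rewrite onth_cat ifF; last by lia.
  by have -> : (size u).+1 + p - size u = p.+1 by lia.
have endu : onth u (size u) <> Some a by rewrite onth_default.
apply/runs_dvdP/andP => [dvd | [/runs_dvdP dvdu /runs_dvdP dvdv] i j].
  split; apply/runs_dvdP=> i j /is_runP[ltij run before after].
    have leju : j <= size u.
      have : onth u j.-1 by rewrite run //; lia.
      by rewrite onthTE; lia.
    apply: dvd; apply/is_runP; split=> // [p lepj | i_gt0 |].
    - by rewrite atl ?run //; lia.
    - by rewrite atl; [exact: before | lia].
    - have [-> // | ltju] := eqVneq j (size u).
      by rewrite atl //; lia.
  rewrite -(subnDl (size u).+1); apply: dvd; apply/is_runP; split=> [|p lepj|_|].
  - by rewrite ltn_add2l.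
  - have -> : p = (size u).+1 + (p - (size u).+1) by lia.
    by rewrite atr run //; lia.
  - case: i before {ltij run} => [_ | i before]; first by rewrite addn0.
    have -> : ((size u).+1 + i.+1).-1 = (size u).+1 + i by lia.
    by rewrite atr; apply: before.
  - by rewrite atr.
move=> /is_runP[ltij run before after].
have [leju | ltuj] := leqP j (size u).
  apply: dvdu; apply/is_runP; split=> // [p lepj | i_gt0 |].
  - by rewrite -atl ?run //; lia.
  - by rewrite -atl; [exact: before | lia].
  - have [-> // | ltju] := eqVneq j (size u).
    by rewrite -atl //; lia.
(* A run of [a] beyond [size u] cannot contain that position, which holds [x]. *)
have ltui : size u < i.
  by rewrite ltnNge; apply/negP=> leiu; apply: atx; apply: run; lia.
have -> : j - i = (j - (size u).+1) - (i - (size u).+1) by lia.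
apply: dvdv; apply/is_runP; split=> [|p lepj|i_gt0|]; rewrite -?atr.
- by lia.
- by apply: run; lia.
- have -> : (size u).+1 + (i - (size u).+1).-1 = i.-1 by lia.
  by apply: before; lia.
- by rewrite subnKC.
Qed.

Lemma runs_dvd_nseq a d k : runs_dvd a d (nseq k a) = (d %| k).
Proof.
apply/runs_dvdP/idP => [dvd | dvdk i j /is_runP[ltij run before after]].
  case: k dvd => [|k] dvd; first by rewrite dvdn0.
  rewrite -[k.+1]subn0; apply: dvd; apply/is_runP; split=> // [p /andP[_ ltp]|].
    by rewrite onth_nseq ltp.
  by rewrite onth_nseq ltnn.
have lejk : j <= k.
  have : onth (nseq k a) j.-1 by rewrite run //; lia.
  by rewrite onthTE size_nseq; lia.
have -> : i = 0.
  case: i ltij before {run} => // i ltij /(_ isT) []; rewrite onth_nseq ifT //=.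
  by lia.
suff -> : j = k by rewrite subn0.
by apply/eqP; rewrite eqn_leq lejk leqNgt; apply/negP=> ltjk; case: after;
  rewrite onth_nseq ltjk.
Qed.

Lemma runs_dvd_nil a d : runs_dvd a d [::].
Proof. by rewrite (runs_dvd_nseq a d 0) dvdn0. Qed.

Lemma runs_dvd_cons a d x w : x != a -> runs_dvd a d (x :: w) = runs_dvd a d w.
Proof. by move=> neqxa; rewrite (runs_dvd_sep d [::]) // runs_dvd_nil. Qed.

(** The initial run of [a], when there is one, becomes longer by [d], and the
    other runs keep their lengths. *)
Lemma runs_dvd_block a d w : runs_dvd a d (nseq d a ++ w) = runs_dvd a d w.
Proof.
have [c [->|[x [v [neqxa ->]]]]] :
    exists c, w = nseq c a \/ exists x v, x != a /\ w = nseq c a ++ x :: v.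
  elim: w => [|x w [c IH]]; first by exists 0; left.
  have [->|neqxa] := eqVneq x a; last by exists 0; right; exists x, w.
  by exists c.+1; case: IH => [->|[y [v [? ->]]]]; [left|right; exists y, v].
- by rewrite -nseqD !runs_dvd_nseq dvdn_addr.
- by rewrite catA -nseqD !runs_dvd_sep // !runs_dvd_nseq dvdn_addr.
Qed.

(** * The property R, letter by letter *)

Lemma satR_sep u x v : 1 < x -> satR (u ++ x :: v) = satR u && satR v.
Proof. by move=> x_gt1; rewrite /satR !runs_dvd_sep; lia. Qed.

Lemma satR_nil : satR [::].
Proof. by rewrite /satR !runs_dvd_nil. Qed.

Lemma satR_cons x w : 1 < x -> satR (x :: w) = satR w.
Proof. by move=> /(satR_sep [::] w) /= ->; rewrite satR_nil. Qed.

Lemma satR_00 w : satR [:: 0, 0 & w] = satR w.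
Proof. by rewrite /satR (runs_dvd_block 0 2) !(@runs_dvd_cons 1). Qed.

Lemma satR_111 w : satR [:: 1, 1, 1 & w] = satR w.
Proof. by rewrite /satR (runs_dvd_block 1 3) !(@runs_dvd_cons 0). Qed.

(** The default value of [head] differs from [a], so that the end of the word
    also stops the initial run. *)
Lemma runs_dvd_short a d k w : 0 < k < d -> head a.+1 w != a ->
  runs_dvd a d (nseq k a ++ w) = false.
Proof.
move=> kd; have ndvd : d %| k = false by rewrite gtnNdvd //; lia.
case: w => [_|x v /= neqxa]; first by rewrite cats0 runs_dvd_nseq.
by rewrite runs_dvd_sep // runs_dvd_nseq ndvd.
Qed.

Lemma satR_0short w : head 1 w != 0 -> satR (0 :: w) = false.
Proof. by move=> hw; rewrite /satR (@runs_dvd_short 0 2 1). Qed.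

Lemma satR_1short w : head 2 w != 1 -> satR (1 :: w) = false.
Proof. by move=> hw; rewrite /satR (@runs_dvd_short 1 3 1) // andbF. Qed.

Lemma satR_11short w : head 2 w != 1 -> satR [:: 1, 1 & w] = false.
Proof. by move=> hw; rewrite /satR (@runs_dvd_short 1 3 2) // andbF. Qed.

(** * Counting words *)

(** The number of words of length [l] over [{0, ..., r}] satisfying [P].
    Here the words are plain sequences, so that they can be cut and
    concatenated, and [P] may refer to letters outside the alphabet. *)
Fixpoint nwords (r : nat) (P : pred (seq nat)) (l : nat) : nat :=
  if l is l'.+1 then \sum_(x < r.+1) nwords r (fun w => P (nat_of_ord x :: w)) l'
  else P [::].

Lemma card_nwords r (P : pred (seq nat)) l :
  #|[set w : l.-tuple 'I_r.+1 | P [seq nat_of_ord x | x <- w]]| = nwords r P l.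
Proof.
elim: l P => [|l IH] P; rewrite -sum1dep_card.
  rewrite (eq_bigl (fun=> P [::])) => [|w]; last by rewrite tuple0.
  rewrite /=; case: (P [::]); last by rewrite big_pred0_eq.
  by transitivity #|{: 0.-tuple 'I_r.+1}|; [rewrite sum1_card | rewrite card_tuple].
rewrite (reindex (fun p : 'I_r.+1 * l.-tuple 'I_r.+1 => [tuple of p.1 :: p.2])).
  rewrite -(pair_big_dep xpredT
    (fun x (w : l.-tuple 'I_r.+1) => P [seq nat_of_ord y | y <- x :: w])
    (fun _ _ => 1)) /=.
  by apply: eq_bigr => x _; rewrite -IH sum1dep_card.
exists (fun w : l.+1.-tuple 'I_r.+1 => (thead w, [tuple of behead w])).
  by move=> [x w] _; rewrite /= theadE; congr (_, _); apply: val_inj.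
by move=> w _ /=; rewrite [RHS]tuple_eta.
Qed.

Lemma eq_nwords r (P Q : pred (seq nat)) l :
  P =1 Q -> nwords r P l = nwords r Q l.
Proof.
elim: l P Q => [|l IH] P Q eqPQ /=; first by rewrite eqPQ.
by apply: eq_bigr => x _; apply: IH => w.
Qed.

Lemma nwords_pred0 r l : nwords r (fun=> false) l = 0.
Proof. by elim: l => //= l IH; rewrite big1. Qed.

Lemma nwords_andb r (b : bool) (P : pred (seq nat)) l :
  nwords r (fun w => b && P w) l = b * nwords r P l.
Proof. by case: b; rewrite ?mul1n //= mul0n nwords_pred0. Qed.

(** Used when the part of the word already read leaves a single choice for
    the next letter. *)
Lemma nwords_forced r a (P : pred (seq nat)) l : a <= r ->
  (forall b w, b != a -> P (b :: w) = false) ->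
  nwords r P l.+1 = nwords r (fun w => P (a :: w)) l.
Proof.
move=> lear P0 /=; have ltar : a < r.+1 by [].
rewrite (bigD1 (Ordinal ltar)) //= big1 ?addn0 // => x neqx.
by rewrite -[RHS](nwords_pred0 r l); apply: eq_nwords => w; apply: P0.
Qed.

(** A nonempty word satisfying R starts with [00], with [111] or
    with a letter above 1, and what follows is again arbitrary. *)
Lemma nwords_satR_rec m l :
  nwords m.+1 satR l.+1 =
    m * nwords m.+1 satR l
    + (if l is l'.+1 then nwords m.+1 satR l' else 0)
    + (if l is l'.+2 then nwords m.+1 satR l' else 0).
Proof.
rewrite [LHS]/= !big_ord_recl /=.
have -> : \sum_(i < m) nwords m.+1
             (fun w => satR (bump 0 (bump 0 i) :: w)) l = m * nwords m.+1 satR l.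
  rewrite -[X in _ = X * _](card_ord m) -sum_nat_const.
  by apply: eq_bigr => i _; apply: eq_nwords => w; rewrite satR_cons.
rewrite addnA [LHS]addnC -addnA; congr (_ + (_ + _)).
  case: l => [|l]; first by rewrite /= satR_0short.
  rewrite (@nwords_forced _ 0) // => [|b w b0]; last by rewrite satR_0short.
  by apply: eq_nwords => w; rewrite satR_00.
case: l => [|l]; first by rewrite /= satR_1short.
rewrite (@nwords_forced _ 1) // => [|b w b0]; last by rewrite satR_1short.
case: l => [|l]; first by rewrite /= satR_11short.
rewrite (@nwords_forced _ 1) // => [|b w b0]; last by rewrite satR_11short.
by apply: eq_nwords => w; rewrite satR_111.
Qed.

(** * The largest letter as a separator *)

Lemma nwords_no_top r (F P : pred (seq nat)) l :
  {in [pred u | all (leq^~ r) u], F =1 P} ->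
  (forall u, r.+1 \in u -> F u = false) ->
  nwords r.+1 F l = nwords r P l.
Proof.
elim: l F P => [|l IH] F P eqFP F0 /=; first by rewrite eqFP.
rewrite big_ord_recr /= [X in _ + X = _](_ : _ = 0) ?addn0.
  apply: eq_bigr => x _; apply: IH => [u allu | u topu].
    by apply: eqFP; rewrite inE /= -ltnS ltn_ord.
  by apply: F0; rewrite inE topu orbT.
rewrite -[RHS](nwords_pred0 r.+1 l); apply: eq_nwords => u.
by apply: F0; rewrite mem_head.
Qed.

(** Classify the words by the length [i] of the part [u] before the first
    occurrence of the largest letter.  Both [F] and [P] vary in the induction
    on [l], as the letters of [u] are read one after the other. *)
Lemma nwords_top r (F P Q : pred (seq nat)) l :
  (forall u v, all (leq^~ r) u -> F (u ++ r.+1 :: v) = P u && Q v) ->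
  (forall u, all (leq^~ r) u -> F u = false) ->
  nwords r.+1 F l = \sum_(i < l) nwords r P i * nwords r.+1 Q (l - i.+1).
Proof.
elim: l F P => [|l IH] F P FPQ F0 /=; first by rewrite F0 // big_ord0.
rewrite [LHS]big_ord_recr [RHS]big_ord_recl [LHS]addnC /= subn1; congr (_ + _).
  by rewrite -nwords_andb; apply: eq_nwords => v; apply: (FPQ [::]).
under eq_bigr => x _.
  rewrite (IH _ (fun u => P (nat_of_ord x :: u))); first over.
  - by move=> u v allu; apply: (FPQ (_ :: u)); rewrite /= -ltnS ltn_ord.
  - by move=> u allu; apply: F0; rewrite /= -ltnS ltn_ord.
rewrite exchange_big /=; apply: eq_bigr => i _.
by rewrite big_distrl.
Qed.

Definition satR_tops (t j : nat) (w : seq nat) : bool :=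
  satR w && (count_mem t w == j).

Lemma count_top_le r u : all (leq^~ r) u -> count_mem r.+1 u = 0.
Proof.
move=> allu; apply/count_memPn/negP => /(allP allu).
by rewrite ltnn.
Qed.

Lemma nwords_satR_no_top r l :
  nwords r.+1 (satR_tops r.+1 0) l = nwords r satR l.
Proof.
apply: nwords_no_top => [u allu | u]; rewrite /satR_tops.
  by rewrite count_top_le // andbT.
by rewrite -has_pred1 has_count; case: count => // n; rewrite andbF.
Qed.

Lemma nwords_satR_top r j l : 0 < r ->
  nwords r.+1 (satR_tops r.+1 j.+1) l =
    \sum_(i < l) nwords r satR i * nwords r.+1 (satR_tops r.+1 j) (l - i.+1).
Proof.
move=> r_gt0; apply: nwords_top => [u v allu | u allu]; rewrite /satR_tops.
  rewrite satR_sep // count_cat /= eqxx count_top_le // add0n add1n eqSS.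
  by rewrite andbA.
by rewrite count_top_le // andbF.
Qed.

Lemma nwords_partition r (P : pred (seq nat)) (g : seq nat -> nat) N l :
  (forall w, size w = l -> g w <= N) ->
  \sum_(j < N.+1) nwords r (fun w => P w && (g w == j)) l = nwords r P l.
Proof.
elim: l P g => [|l IH] P g leg /=.
  have ltg : g [::] < N.+1 by apply: leg.
  rewrite (bigD1 (Ordinal ltg)) //= eqxx andbT big1 ?addn0 // => j neqj.
  rewrite [_ == _]negbTE ?andbF //; apply: contra neqj => /eqP eqj.
  exact/eqP/val_inj.
rewrite exchange_big /=; apply: eq_bigr => x _.
by apply: (IH (fun w => P (_ :: w)) (fun w => g (_ :: w))) => w sw;
  apply: leg; rewrite /= sw.
Qed.

(** * Sums over compositions *)

(** The index type of the summation may be enlarged, which lets the bound stay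
    fixed while [n] decreases in the recursion on [k]. *)
Definition bounded_composition_sum (f : nat -> nat) (N n k : nat) : nat :=
  \sum_(i : {ffun 'I_k -> 'I_N.+1} |
          [forall j, 0 < i j] && (\sum_(j < k) i j == n))
     \prod_(j < k) f (i j).

Lemma bounded_composition_sum0 f N n :
  bounded_composition_sum f N n 0 = (n == 0).
Proof.
have all0 (i : {ffun 'I_0 -> 'I_N.+1}) : [forall j, 0 < i j].
  by apply/forallP => -[].
rewrite /bounded_composition_sum.
under eq_bigl => i do rewrite all0 big_ord0 eq_sym.
under eq_bigr => i _ do rewrite big_ord0.
case: (n == 0); last by rewrite big_pred0_eq.
transitivity #|{: {ffun 'I_0 -> 'I_N.+1}}|; first by rewrite sum1_card.
by rewrite card_ffun !card_ord.
Qed.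

(** The first part of the composition is [i.+1], as parts are positive. *)
Lemma bounded_composition_sumS f N n k : n <= N ->
  bounded_composition_sum f N n k.+1 =
    \sum_(i < n) f i.+1 * bounded_composition_sum f N (n - i.+1) k.
Proof.
move=> lenN; rewrite /bounded_composition_sum.
pose glue (p : 'I_N.+1 * {ffun 'I_k -> 'I_N.+1}) : {ffun 'I_k.+1 -> 'I_N.+1} :=
  [ffun j => if unlift ord0 j is Some j' then p.2 j' else p.1].
have glue0 p : glue p ord0 = p.1 by rewrite ffunE unlift_none.
have glueS p j : glue p (lift ord0 j) = p.2 j by rewrite ffunE liftK.
rewrite (reindex glue); last first.
  exists (fun i : {ffun 'I_k.+1 -> 'I_N.+1} =>
    (i ord0, [ffun j : 'I_k => i (lift ord0 j)])) => [[x i] _ | i _].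
    by congr (_, _); [exact: glue0 | apply/ffunP=> j; rewrite ffunE glueS].
  apply/ffunP=> j; rewrite ffunE.
  by case: unliftP => [j' ->|->] //=; rewrite ffunE.
transitivity (\sum_(x < N.+1 | 0 < x <= n)
  \sum_(i : {ffun 'I_k -> 'I_N.+1} |
     [forall j, 0 < i j] && (\sum_(j < k) i j == n - x))
    f x * \prod_(j < k) f (i j)).
  rewrite pair_big_dep /=; apply: eq_big => [p | p _]; last first.
    rewrite big_ord_recl glue0; congr (_ * _).
    by apply: eq_bigr => j _; rewrite glueS.
  have sumE : \sum_(j < k) glue p (lift ord0 j) = \sum_(j < k) p.2 j.
    by apply: eq_bigr => j _; rewrite glueS.
  rewrite big_ord_recl glue0 sumE.
  have -> : [forall j, 0 < glue p j] = (0 < p.1) && [forall j, 0 < p.2 j].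
    apply/forallP/andP => [gt0 | [p1 /forallP p2] j].
      split; first by rewrite -(glue0 p).
      by apply/forallP=> j; rewrite -(glueS p).
    by rewrite ffunE; case: unlift.
  move: [forall j, _] (\sum_(j < k) p.2 j) => b s.
  by case: b; lia.
under eq_bigr => x _ do rewrite -big_distrr /=.
pose G x := f x * bounded_composition_sum f N (n - x) k.
rewrite -(big_mkord (fun x => 0 < x <= n) G) big_ltn_cond //= big_add1 /=.
rewrite big_mkord -(big_mkord xpredT (G \o S)) /= (big_nat_widen 0 n N) //.
by rewrite big_mkord.
Qed.

(** The parts of a composition are one more than the lengths of the words
    between separators, each part but the last also covering the separator
    that follows its word: hence the shifts by one in both [n] and [k]. *)
Lemma bounded_composition_sum_words f r N n k : 0 < r ->
  (forall l, f l.+1 = nwords r satR l) -> n <= N ->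
  bounded_composition_sum f N n k.+1 =
    if n is l.+1 then nwords r.+1 (satR_tops r.+1 k) l else 0.
Proof.
move=> r_gt0 fE; elim: k n => [|k IH] [|l] leN; rewrite bounded_composition_sumS //.
- by rewrite big_ord0.
- rewrite big_ord_recr /= subnn bounded_composition_sum0 muln1.
  rewrite nwords_satR_no_top -fE big1 // => i _.
  rewrite bounded_composition_sum0; have := ltn_ord i; lia.
- by rewrite big_ord0.
- rewrite big_ord_recr /= subnn IH // muln0 addn0 nwords_satR_top //.
  apply: eq_bigr => i _; rewrite fE IH; last by lia.
  by have -> : l.+1 - i.+1 = (l - i.+1).+1 by have := ltn_ord i; lia.
Qed.

Lemma composition_sum_words f r n k : 0 < r ->
  (forall l, f l.+1 = nwords r satR l) ->
  composition_sum f n.+1 k.+1 = nwords r.+1 (satR_tops r.+1 k) n.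
Proof.
by move=> r_gt0 fE; apply: (bounded_composition_sum_words _ r_gt0 fE (leqnn _)).
Qed.

Lemma iter_f_words m l : iter_f binary_f0 m l.+1 = nwords m.+1 satR l.
Proof.
elim: m l => [|m IH] l; first by rewrite -card_nwords.
rewrite /= big_add1 big_mkord.
under eq_bigr => k _ do rewrite (composition_sum_words _ _ _ IH) //.
by apply: nwords_partition => w <-; apply: count_size.
Qed.

Theorem corollary11 :
  [/\ forall m : nat,
        [/\ iter_f binary_f0 m 1 = 1,
            iter_f binary_f0 m 2 = m,
            iter_f binary_f0 m 3 = m ^ 2 + 1
          & forall n : nat, 1 < n ->
              iter_f binary_f0 m (n + 3) =
                m * iter_f binary_f0 m (n + 2) + iter_f binary_f0 m (n + 1)
                + iter_f binary_f0 m n],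
      forall m n : nat, 1 <= n ->
        iter_f binary_f0 m n = #|Rwords m.+1 n.-1|
    & forall m n k : nat, 1 <= m -> 1 <= k <= n ->
        iter_c binary_f0 m n k =
          #|[set w in Rwords m.+1 n.-1 | count_mem ord_max w == k.-1]| ].
Proof.
split=> [m | m [//|l] _ | [//|m] [|l] [|k] // _ _].
- have nil1 : nwords m.+1 satR 0 = 1 by rewrite /= satR_nil.
  rewrite !iter_f_words !nwords_satR_rec nil1 muln1 !addn0.
  split=> // -[//|l] _.
  by rewrite addn3 addn2 addn1 !iter_f_words [LHS]nwords_satR_rec.
- by rewrite iter_f_words -card_nwords.
- rewrite /iter_c (composition_sum_words _ _ _ (iter_f_words m)) // -card_nwords.
  apply: eq_card => w; rewrite !inE /satR_tops count_map; congr (_ && (_ == _)).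
Qed.
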